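(* If three triangles $A_1B_1C_1$, $A_2B_2C_2$, $A_3B_3C_3$ are homological two by two and their homological centers (of the pairs $(1,2)$, $(2,3)$ and $(3,1)$) are collinear, then the triangles have the same homological axis, i.e. the homological axes of the three pairs coincide.
   Context: The triangles lie in a plane, and vertices denoted by the same letter correspond to each other. Two triangles $ABC$ and $A'B'C'$, with vertex correspondence $A\leftrightarrow A'$, $B\leftrightarrow B'$, $C\leftrightarrow C'$, are called homological if the lines $AA'$, $BB'$, $CC'$ are concurrent; their common point is the homological center of the two triangles. By Desargues' theorem the intersection points $BC\cap B'C'$, $CA\cap C'A'$, $AB\cap A'B'$ of corresponding sides are then collinear, and the line containing them is the homological axis of the two triangles. Three triangles are homological two by two if each pair of them is homological.
   Formalization: Added: A1,A2,A3 are not collinear, likewise the B's and the C's (else false: common center, or A's on the line of centers). For each pair, corresponding vertices are distinct and AA', BB', CC' are three different lines. Set in the real projective plane. *)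

(* Defs.v *)
From HB Require Import structures.
From mathcomp Require Import all_boot all_order all_algebra.
From mathcomp Require Import reals.

Set Implicit Arguments.
Unset Strict Implicit.
Unset Printing Implicit Defensive.

(* The plane is the real projective plane, i.e. the Euclidean
   plane completed by its points at infinity, (x, y) being the line spanned by
   (x, y, 1).  Its points and lines are the subspaces of R^3 of dimension 1
   and 2, and incidence is inclusion. *)

Record point (R : realType) := Point {
  point_space :> {vspace 'rV[R]_3};
  point_dim : \dim point_space == 1%N }.

HB.instance Definition _ (R : realType) := [isSub for @point_space R].
HB.instance Definition _ (R : realType) := [Equality of point R by <:].

Record line (R : realType) := Line {
  line_space :> {vspace 'rV[R]_3};
  line_dim : \dim line_space == 2%N }.

HB.instance Definition _ (R : realType) := [isSub for @line_space R].
HB.instance Definition _ (R : realType) := [Equality of line R by <:].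

Definition collinear (R : realType) (P Q S : point R) : Prop :=
  exists l : line R, [/\ (P <= l)%VS, (Q <= l)%VS & (S <= l)%VS].

(* A line (of dimension 2) only if P != Q. *)
Definition through (R : realType) (P Q : point R) : {vspace 'rV[R]_3} :=
  (P + Q)%VS.

(* Concurrent lines are understood to be three different lines. *)
Definition concurrent (R : realType) (l m n : {vspace 'rV[R]_3}) : Prop :=
  [/\ l != m, m != n, n != l &
      exists P : point R, [/\ (P <= l)%VS, (P <= m)%VS & (P <= n)%VS]].

Record triangle (R : realType) := Triangle {
  vA : point R;
  vB : point R;
  vC : point R;
  triangle_proper : ~ collinear vA vB vC }.

(* Corresponding vertices are different, so that AA', BB', CC' are lines.
   These three lines are pairwise different exactly when corresponding sides
   are different, i.e. when the latter meet in a single point. *)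
Definition homological (R : realType) (T T' : triangle R) : Prop :=
  [/\ vA T != vA T', vB T != vB T', vC T != vC T' &
      concurrent (through (vA T) (vA T')) (through (vB T) (vB T'))
                 (through (vC T) (vC T'))].

Definition homological_center (R : realType) (T T' : triangle R)
    (O : point R) : Prop :=
  [/\ (O <= through (vA T) (vA T'))%VS, (O <= through (vB T) (vB T'))%VS &
      (O <= through (vC T) (vC T'))%VS].

(* l is the one and only line containing the points where corresponding sides
   meet. *)
Definition homological_axis (R : realType) (T T' : triangle R) (l : line R)
    : Prop :=
  unique (fun m : line R =>
    [/\ (through (vB T) (vC T) :&: through (vB T') (vC T') <= m)%VS,
        (through (vC T) (vA T) :&: through (vC T') (vA T') <= m)%VS &
        (through (vA T) (vB T) :&: through (vA T') (vB T') <= m)%VS]) l.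

(* Main.v *)
Require Import Defs.
From mathcomp Require Import all_boot all_order all_algebra.
From mathcomp Require Import reals.

(** Read the nine vertices by columns.  The triangles A1A2A3 and B1B2B3 have
    corresponding sides meeting in the three homological centers, which are
    collinear, so by the converse of Desargues' theorem the lines A1B1, A2B2,
    A3B3 pass through one point; the same holds for the sides BC and CA.
    Hence corresponding sides of each pair of the given triangles meet in the
    same three points, which are different and, by Desargues' theorem,
    collinear: they determine the common axis. *)

Import GRing.Theory.
Local Open Scope ring_scope.

(** * Linear algebra: subspaces of given dimension, small free families, and Desargues' theorem with
    its converse for vectors *)

Section VectorSpaces.

Set Implicit Arguments.
Unset Strict Implicit.

Variables (K : fieldType) (vT : vectType K).
Implicit Types (U V : {vspace vT}) (u v w : vT).

(** Vectors outside the current subspace are adjoined one at a time. This yields a line through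
    points whose span may be too small. *)
Lemma sub_vspace_dim U n :
  (\dim U <= n <= \dim {:vT})%N -> exists2 W : {vspace vT}, (U <= W)%VS & \dim W = n.
Proof.
case/andP=> /subnKC; move: (n - \dim U)%N => k.
elim: k n => [|k IH] n <-; first by exists U; rewrite ?addn0.
rewrite addnS => lt_n; have [W sUW dimW] := IH _ erefl (ltnW lt_n).
have /subvPn[v _ vW] : ~~ ({:vT} <= W)%VS.
  by apply: contraL lt_n => /dimvS; rewrite dimW -leqNgt.
exists (W + <[v]>)%VS; first exact: subv_trans (addvSl _ _).
rewrite dimv_disjoint_sum ?dimW ?dim_vline.
  by case: eqP vW => [->|_ _]; rewrite ?mem0v // addn1.
apply/eqP; rewrite -subv0; apply/subvP=> x; rewrite memv_cap memv0.
case/andP=> xW /vlineP[c xE]; rewrite xE; move: xW; rewrite xE.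
by have [->|c0] := eqVneq c 0; [rewrite scale0r | rewrite rpredZeq (negPf c0) (negPf vW)].
Qed.

Lemma memv_line_addP u v w :
  reflect (exists x y, w = x *: u + y *: v) (w \in <[u]> + <[v]>)%VS.
Proof.
apply: (iffP memv_addP) => [[_ /vlineP[x ->] [_ /vlineP[y ->] ->]]|[x [y ->]]].
  by exists x, y.
by exists (x *: u); [|exists (y *: v)]; rewrite // memvZ ?memv_line.
Qed.

Lemma free3P u v w :
  reflect (forall x y z, x *: u + y *: v + z *: w = 0 -> [/\ x = 0, y = 0 & z = 0])
          (free [:: u; v; w]).
Proof.
apply: (iffP (@freeP _ _ _ [tuple u; v; w])) => [H x y z e|H k].
  have := H (fun i => [:: x; y; z]`_i).
  rewrite !big_ord_recl big_ord0 /= addr0 addrA => /(_ e) k0.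
  by split; [apply: (k0 ord0) | apply: (k0 (lift ord0 ord0))
            | apply: (k0 (lift ord0 (lift ord0 ord0)))].
rewrite !big_ord_recl big_ord0 /= addr0 addrA => /H[k0 k1 k2] [[|[|[|i]]] lti] //;
  [rewrite -k0 | rewrite -k1 | rewrite -k2]; congr k; exact: val_inj.
Qed.

Lemma free2P u v :
  reflect (forall x y, x *: u + y *: v = 0 -> x = 0 /\ y = 0) (free [:: u; v]).
Proof.
apply: (iffP (@freeP _ _ _ [tuple u; v])) => [H x y e|H k].
  have := H (fun i => [:: x; y]`_i).
  rewrite !big_ord_recl big_ord0 /= addr0 => /(_ e) k0.
  by split; [apply: (k0 ord0) | apply: (k0 (lift ord0 ord0))].
rewrite !big_ord_recl big_ord0 /= addr0 => /H[k0 k1] [[|[|i]] lti] //;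
  [rewrite -k0 | rewrite -k1]; congr k; exact: val_inj.
Qed.

Lemma nfree3P u v w : ~~ free [:: u; v; w] ->
  exists x y z, [|| x != 0, y != 0 | z != 0] /\ x *: u + y *: v + z *: w = 0.
Proof.
have n0 : 1 != 0 :> K by exact: oner_neq0.
rewrite free_cons negb_and negbK span_cons span_seq1 => /orP[|].
  case/memv_line_addP=> [y [z ->]]; exists (- 1), y, z.
  by rewrite oppr_eq0 n0 scaleN1r -addrA addNr.
rewrite free_cons negb_and negbK span_seq1 seq1_free negbK => /orP[|/eqP->].
  case/vlineP=> [z ->]; exists 0, (- 1), z.
  by rewrite oppr_eq0 n0 orbT scale0r add0r scaleN1r addNr.
by exists 0, 0, 1; rewrite n0 !orbT !scale0r scaler0 !addr0.
Qed.

(** Since the [o]'s sum to zero, they are the cyclic differences of suitable multiples of the [a]'s,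
    and likewise of the [b]'s. Equating the two forms shows that [x *: a1 - x' *: b1] and its two
    analogues are one vector, the required [p]. *)
Lemma desargues_converse_vectors (a1 a2 a3 b1 b2 b3 o12 o23 o31 : vT) :
  free [:: a1; a2; a3] -> free [:: b1; b2; b3] ->
  free [:: a1; b1] -> free [:: a2; b2] -> free [:: a3; b3] ->
  o12 \in (<[a1]> + <[a2]>)%VS -> o12 \in (<[b1]> + <[b2]>)%VS ->
  o23 \in (<[a2]> + <[a3]>)%VS -> o23 \in (<[b2]> + <[b3]>)%VS ->
  o31 \in (<[a3]> + <[a1]>)%VS -> o31 \in (<[b3]> + <[b1]>)%VS ->
  o12 + o23 + o31 = 0 -> [|| o12 != 0, o23 != 0 | o31 != 0] ->
  exists2 p, p != 0 &
    [/\ p \in (<[a1]> + <[b1]>)%VS, p \in (<[a2]> + <[b2]>)%VS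
      & p \in (<[a3]> + <[b3]>)%VS].
Proof.
move=> fa fb /free2P f1 /free2P f2 /free2P f3.
have coords (c1 c2 c3 : vT) : free [:: c1; c2; c3] ->
    o12 \in (<[c1]> + <[c2]>)%VS -> o23 \in (<[c2]> + <[c3]>)%VS ->
    o31 \in (<[c3]> + <[c1]>)%VS -> o12 + o23 + o31 = 0 ->
    exists x y z, [/\ o12 = x *: c1 - y *: c2, o23 = y *: c2 - z *: c3
                    & o31 = z *: c3 - x *: c1].
  move=> /free3P fc /memv_line_addP[x1 [x2 ->]] /memv_line_addP[y2 [y3 ->]].
  case/memv_line_addP=> [z3 [z1 ->]] e.
  (* Each vector [c1], [c2], [c3] occurs in two of the three sums, so freeness makes its two
     coefficients opposite. *)
  have [/eqP e1 /eqP e2 /eqP e3] : [/\ x1 + z1 = 0, x2 + y2 = 0 & y3 + z3 = 0].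
    apply: fc; rewrite -[RHS]e !scalerDl.
    by rewrite [RHS](AC (2*2*2) ((1*6)*(2*3)*(4*5))).
  exists x1, y2, z3; move: e1 e2 e3; rewrite !addr_eq0 => /eqP-> /eqP-> /eqP->.
  by rewrite !scaleNr opprK.
move=> oa12 ob12 oa23 ob23 oa31 ob31 e0.
have [x [y [z [a12 a23 a31]]]] := coords _ _ _ fa oa12 oa23 oa31 e0.
have [x' [y' [z' [b12 b23 b31]]]] := coords _ _ _ fb ob12 ob23 ob31 e0.
have p12 : x *: a1 - x' *: b1 = y *: a2 - y' *: b2.
  have -> : x *: a1 = o12 + y *: a2 by rewrite a12 subrK.
  by rewrite b12 [LHS](ACl (3*2*(1*4))) /= subrr addr0.
have p23 : y *: a2 - y' *: b2 = z *: a3 - z' *: b3.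
  have -> : y *: a2 = o23 + z *: a3 by rewrite a23 subrK.
  by rewrite b23 [LHS](ACl (3*2*(1*4))) /= subrr addr0.
have mem c d (u v : vT) : c *: u - d *: v \in (<[u]> + <[v]>)%VS.
  by apply/memv_line_addP; exists c, (- d); rewrite scaleNr.
move=> o_n0; exists (x *: a1 - x' *: b1); last by split; [|rewrite p12|rewrite p12 p23]; apply: mem.
(* If [p] vanished, freeness of each pair [a], [b] would give [x = y = z = 0], and all three [o]'s
   would be zero. *)
apply: contraTneq o_n0 => p0.
have [x0 _] : x = 0 /\ - x' = 0 by apply: f1; rewrite scaleNr.
have [y0 _] : y = 0 /\ - y' = 0 by apply: f2; rewrite scaleNr -p12.
have [z0 _] : z = 0 /\ - z' = 0 by apply: f3; rewrite scaleNr -p23 -p12.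
by rewrite a12 a23 a31 x0 y0 z0 !scale0r subr0 eqxx.
Qed.

(** Writing [o] in three ways, as [x *: a + x' *: a'] and so on, and subtracting gives
    [x *: a - y *: b = y' *: b' - x' *: a'], a vector on both corresponding sides. The three cyclic
    differences telescope to zero. *)
Lemma desargues_vectors (a b c a' b' c' o : vT) :
  free [:: a; b] -> free [:: b; c] -> free [:: c; a] ->
  free [:: a'; b'] -> free [:: b'; c'] -> free [:: c'; a'] -> o != 0 ->
  o \in (<[a]> + <[a']>)%VS -> o \in (<[b]> + <[b']>)%VS ->
  o \in (<[c]> + <[c']>)%VS ->
  exists p q r, [/\ [/\ p != 0, q != 0 & r != 0],
    p \in ((<[b]> + <[c]>) :&: (<[b']> + <[c']>))%VS,
    q \in ((<[c]> + <[a]>) :&: (<[c']> + <[a']>))%VS,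
    r \in ((<[a]> + <[b]>) :&: (<[a']> + <[b']>))%VS & p + q + r = 0].
Proof.
move=> fab fbc fca fab' fbc' fca' o0 /memv_line_addP[x [x' ox]].
case/memv_line_addP=> [y [y' oy]] /memv_line_addP[z [z' oz]].
(* If the difference were zero, freeness of [u], [v] would give [s = t = 0]; then
   [o = s' *: u' = t' *: v'], and freeness of [u'], [v'] would force [o = 0]. *)
have diff_n0 (u u' v v' : vT) s s' t t' : free [:: u; v] -> free [:: u'; v'] ->
    o = s *: u + s' *: u' -> o = t *: v + t' *: v' -> s *: u - t *: v != 0.
  move=> /free2P f /free2P f' os ot; apply: contraNneq o0 => e.
  have [s0 t0] : s = 0 /\ - t = 0 by apply: f; rewrite scaleNr.
  have [s0' _] : s' = 0 /\ - t' = 0.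
    apply: f'; rewrite scaleNr; apply/eqP; rewrite subr_eq0; apply/eqP.
    move: os; rewrite s0 scale0r add0r => <-.
    by rewrite ot -[t]opprK t0 oppr0 scale0r add0r.
  by rewrite os s0 s0' !scale0r addr0.
have mem (u u' v v' : vT) s s' t t' : o = s *: u + s' *: u' -> o = t *: v + t' *: v' ->
    s *: u - t *: v \in ((<[u]> + <[v]>) :&: (<[u']> + <[v']>))%VS.
  move=> os ot; rewrite memv_cap; apply/andP; split.
    by apply/memv_line_addP; exists s, (- t); rewrite scaleNr.
  apply/memv_line_addP; exists (- s'), t'; rewrite scaleNr.
  have -> : s *: u = o - s' *: u' by rewrite os addrK.
  by rewrite {1}ot [LHS](ACl (3*2*(1*4))) /= subrr addr0.
exists (y *: b - z *: c), (z *: c - x *: a), (x *: a - y *: b); split.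
- by split; [apply: diff_n0 oy oz | apply: diff_n0 oz ox | apply: diff_n0 ox oy].
- exact: mem oy oz.
- exact: mem oz ox.
- exact: mem ox oy.
by rewrite !addrA !subrK subrr.
Qed.

End VectorSpaces.

(** * Points and lines of the projective plane as subspaces *)

Section ProjectivePlane.

Set Implicit Arguments.
Unset Strict Implicit.

Variable R : realType.
Implicit Types (P Q S O A B C : point R) (U V : {vspace 'rV[R]_3}).

Lemma point_gen P : exists2 v, v != 0 & P = <[v]>%VS :> {vspace _}.
Proof.
have /eqP dimP := point_dim P; exists (vpick P).
  by rewrite vpick0 -dimv_eq0 dimP.
apply/eqP; rewrite eq_sym eqEdim dim_vline vpick0 -dimv_eq0 dimP.
by rewrite -memvE memv_pick.
Qed.

Lemma point_of_vector (v : 'rV[R]_3) : v != 0 ->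
  exists P, P = <[v]>%VS :> {vspace _}.
Proof.
by move=> v0; have d : \dim <[v]> == 1%N; [rewrite dim_vline v0 | exists (Point d)].
Qed.

Lemma point_sub_eq P Q : (P <= Q)%VS -> P = Q.
Proof.
move=> sPQ; apply: val_inj; apply/eqP; rewrite /= eqEdim sPQ.
by rewrite (eqP (point_dim P)) (eqP (point_dim Q)).
Qed.

Lemma dim_cap_points P Q : P != Q -> (P :&: Q = 0)%VS.
Proof.
move=> neq_PQ; apply/eqP; rewrite -dimv_eq0 -leqn0 leqNgt.
apply: contraNN neq_PQ => cap_gt0; apply/eqP/point_sub_eq.
apply: subv_trans (capvSr P Q); rewrite -[X in (X <= _)%VS](_ : P :&: Q = P)%VS //.
apply/eqP; rewrite eqEdim capvSl (eqP (point_dim P)) //.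
Qed.

Lemma dim_through P Q : P != Q -> \dim (through P Q) = 2%N.
Proof.
move=> /dim_cap_points cap0; rewrite dimv_disjoint_sum //.
by rewrite (eqP (point_dim P)) (eqP (point_dim Q)).
Qed.

Lemma through_eq P Q U :
  P != Q -> \dim U = 2%N -> (P <= U)%VS -> (Q <= U)%VS -> through P Q = U.
Proof.
move=> neq_PQ dimU PU QU; apply/eqP.
by rewrite eqEdim dimU dim_through // subv_add PU QU.
Qed.

Lemma meet_point P U V : \dim U = 2%N -> \dim V = 2%N -> U != V ->
  (P <= U)%VS -> (P <= V)%VS -> (U :&: V = P)%VS.
Proof.
move=> dimU dimV neq_UV PU PV; apply/esym/eqP.
rewrite eqEdim subv_cap PU PV (eqP (point_dim P)) leqNgt.
apply: contraNN neq_UV => cap_gt1.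
have <- : (U :&: V = U)%VS by apply/eqP; rewrite eqEdim capvSl dimU.
by rewrite eqEdim capvSr dimV.
Qed.

(** The bound is not an equality because the points may all coincide; their span is then enlarged to
    a line. *)
Lemma collinear_dim P Q S : (\dim (P + Q + S) <= 2)%N -> collinear P Q S.
Proof.
move=> le2; have [|l sl /eqP dl] := @sub_vspace_dim _ _ (P + Q + S)%VS 2.
  by rewrite le2 dimvf.
exists (Line dl); move: sl; rewrite !subv_add => /andP[/andP[]].
by split.
Qed.

Lemma noncollinear_neq P Q S : ~ collinear P Q S -> [/\ P != Q, Q != S & S != P].
Proof.
have d2 A B : (\dim (A + B)%VS <= 2)%N.
  by have [] := dimv_add_leqif A B; rewrite (eqP (point_dim A)) (eqP (point_dim B)).
move=> ncol; split; apply/eqP=> e; apply: ncol; apply: collinear_dim.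
- by rewrite e addvv.
- by rewrite -addvA e addvv.
- by rewrite e addvC addvA addvv.
Qed.

Lemma noncollinear_free P Q S p q s :
  P = <[p]>%VS :> {vspace _} -> Q = <[q]>%VS :> {vspace _} ->
  S = <[s]>%VS :> {vspace _} ->
  ~ collinear P Q S -> free [:: p; q; s].
Proof.
move=> eP eQ eS ncol; apply: contra_notT ncol => nf; apply: collinear_dim.
rewrite eP eQ eS -addvA -[<[s]>%VS]span_seq1 -!span_cons.
by rewrite -ltnS ltn_neqAle nf dim_span.
Qed.

Lemma collinear_nfree P Q S p q s :
  P = <[p]>%VS :> {vspace _} -> Q = <[q]>%VS :> {vspace _} ->
  S = <[s]>%VS :> {vspace _} ->
  collinear P Q S -> ~~ free [:: p; q; s].
Proof.
move=> eP eQ eS [l [Pl Ql Sl]].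
have /dimvS : (P + (Q + S) <= l)%VS by rewrite !subv_add Pl Ql Sl.
rewrite (eqP (line_dim l)) leqNgt; apply: contraNN => /eqP /=.
by rewrite !span_cons span_nil addv0 -eP -eQ -eS => ->.
Qed.

Lemma neq_free P Q p q :
  P = <[p]>%VS :> {vspace _} -> Q = <[q]>%VS :> {vspace _} ->
  P != Q -> free [:: p; q].
Proof.
move=> eP eQ /dim_through; rewrite /through eP eQ /free.
by rewrite !span_cons span_nil addv0 => ->.
Qed.

(** * Desargues' theorem, its converse, and the axis in the plane *)

Lemma desargues_converse A1 A2 A3 B1 B2 B3 O12 O23 O31 :
  ~ collinear A1 A2 A3 -> ~ collinear B1 B2 B3 ->
  A1 != B1 -> A2 != B2 -> A3 != B3 ->
  (O12 <= through A1 A2)%VS -> (O12 <= through B1 B2)%VS ->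
  (O23 <= through A2 A3)%VS -> (O23 <= through B2 B3)%VS ->
  (O31 <= through A3 A1)%VS -> (O31 <= through B3 B1)%VS ->
  collinear O12 O23 O31 ->
  exists P, [/\ (P <= through A1 B1)%VS, (P <= through A2 B2)%VS
             & (P <= through A3 B3)%VS].
Proof.
have [a1 _ eA1] := point_gen A1; have [b1 _ eB1] := point_gen B1.
have [a2 _ eA2] := point_gen A2; have [b2 _ eB2] := point_gen B2.
have [a3 _ eA3] := point_gen A3; have [b3 _ eB3] := point_gen B3.
have [o12 n12 e12] := point_gen O12; have [o23 n23 e23] := point_gen O23.
have [o31 n31 e31] := point_gen O31.
move=> /(noncollinear_free eA1 eA2 eA3) fA /(noncollinear_free eB1 eB2 eB3) fB.
move=> /(neq_free eA1 eB1) f1 /(neq_free eA2 eB2) f2 /(neq_free eA3 eB3) f3.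
rewrite /through eA1 eA2 eA3 eB1 eB2 eB3 e12 e23 e31 -!memvE.
move=> a12 b12 a23 b23 a31 b31 /(collinear_nfree e12 e23 e31).
(* The coefficients of the linear relation rescale the generators of the three centers so that they
   sum to zero. Not all rescaled vectors vanish, as the generators are nonzero. *)
case/nfree3P=> [x [y [z [xyz0 o0]]]].
have [|p p0 [p1 p2 p3]] := desargues_converse_vectors fA fB f1 f2 f3
  (memvZ x a12) (memvZ x b12) (memvZ y a23) (memvZ y b23)
  (memvZ z a31) (memvZ z b31) o0.
  by rewrite !scaler_eq0 (negPf n12) (negPf n23) (negPf n31) !orbF.
have [P eP] := point_of_vector p0.
by exists P; rewrite eP -!memvE.
Qed.

Lemma desargues A B C A' B' C' O P Q S :
  ~ collinear A B C -> ~ collinear A' B' C' ->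
  (O <= through A A')%VS -> (O <= through B B')%VS -> (O <= through C C')%VS ->
  (through B C :&: through B' C' = P)%VS ->
  (through C A :&: through C' A' = Q)%VS ->
  (through A B :&: through A' B' = S)%VS ->
  (S <= through P Q)%VS.
Proof.
move=> nc nc'.
have [AB BC CA] := noncollinear_neq nc.
have [AB' BC' CA'] := noncollinear_neq nc'.
have [a _ eA] := point_gen A; have [a' _ eA'] := point_gen A'.
have [b _ eB] := point_gen B; have [b' _ eB'] := point_gen B'.
have [c _ eC] := point_gen C; have [c' _ eC'] := point_gen C'.
have [o o0 eO] := point_gen O.
rewrite /through eA eB eC eA' eB' eC' eO -!memvE => oA oB oC eP eQ eS.
have [p [q [s [[p0 q0 s0]]]]] := desargues_vectors (neq_free eA eB AB)
  (neq_free eB eC BC) (neq_free eC eA CA) (neq_free eA' eB' AB')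
  (neq_free eB' eC' BC') (neq_free eC' eA' CA') o0 oA oB oC.
rewrite eP eQ eS => pP qQ sS /eqP.
rewrite addrC addr_eq0 => /eqP es.
have [S' eS'] := point_of_vector s0.
(* [S] is spanned by [s = - (p + q)], which lies in the sum of [P] and [Q]. *)
rewrite -(@point_sub_eq S' S) eS' -memvE // es.
by rewrite memvN memv_add.
Qed.

(** If the lines [A B] and [A' B'] were equal, that line would contain all four points, so [A A']
    and [B B'] would both coincide with it. *)
Lemma sides_neq A A' B B' :
  A != A' -> B != B' -> A != B -> A' != B' ->
  through A A' != through B B' -> through A B != through A' B'.
Proof.
move=> AA' BB' AB AB'; apply: contraNneq => e.
have dimAB := dim_through AB.
rewrite (through_eq AA' dimAB) ?addvSl ?e ?addvSl //.
by rewrite -e (through_eq BB' dimAB) ?addvSr ?e ?addvSr.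
Qed.

(** The indices number the given triangles, so the lines [Ai Bi] are sides with the same letters.
    The converse of Desargues' theorem puts a point on all three; as they are pairwise different,
    each two meet exactly there. *)
Lemma sides_common_point A1 A2 A3 B1 B2 B3 O12 O23 O31 :
  ~ collinear A1 A2 A3 -> ~ collinear B1 B2 B3 ->
  A1 != B1 -> A2 != B2 -> A3 != B3 ->
  through A1 A2 != through B1 B2 -> through A2 A3 != through B2 B3 ->
  through A3 A1 != through B3 B1 ->
  (O12 <= through A1 A2)%VS -> (O12 <= through B1 B2)%VS ->
  (O23 <= through A2 A3)%VS -> (O23 <= through B2 B3)%VS ->
  (O31 <= through A3 A1)%VS -> (O31 <= through B3 B1)%VS ->
  collinear O12 O23 O31 ->
  exists P, [/\ through A1 B1 :&: through A2 B2 = P,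
                through A2 B2 :&: through A3 B3 = P
              & through A3 B3 :&: through A1 B1 = P]%VS.
Proof.
move=> nA nB AB1 AB2 AB3 n12 n23 n31 a12 b12 a23 b23 a31 b31 col.
have [A12 A23 A31] := noncollinear_neq nA.
have [B12 B23 B31] := noncollinear_neq nB.
have [P [P1 P2 P3]] := desargues_converse nA nB AB1 AB2 AB3 a12 b12 a23 b23 a31 b31 col.
by exists P; split; apply: meet_point; rewrite ?dim_through //; apply: sides_neq.
Qed.

(** Two different intersection points already determine the line, which gives the uniqueness
    required of an axis. *)
Lemma axis_through T T' P Q S : P != Q ->
  (through (vB T) (vC T) :&: through (vB T') (vC T') = P)%VS ->
  (through (vC T) (vA T) :&: through (vC T') (vA T') = Q)%VS ->
  (through (vA T) (vB T) :&: through (vA T') (vB T') = S)%VS ->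
  (S <= through P Q)%VS ->
  forall l : line R, l = through P Q :> {vspace _} -> homological_axis T T' l.
Proof.
move=> PQ eP eQ eS SPQ l el; split; rewrite eP eQ eS.
  by rewrite el addvSl addvSr.
move=> m [Pm Qm _]; apply: val_inj; rewrite /= el.
by apply: through_eq; rewrite // (eqP (line_dim m)).
Qed.

Lemma sides_meet_vertex A B C : ~ collinear A B C ->
  (through B C :&: through C A = C)%VS.
Proof.
move=> nABC; have [AB BC CA] := noncollinear_neq nABC.
apply: meet_point; rewrite ?dim_through ?addvSl ?addvSr //.
apply/eqP=> e; apply: nABC; apply: collinear_dim.
by rewrite -addvA -[(B + C)%VS]/(through B C) e addvC -addvA addvv dim_through.
Qed.

End ProjectivePlane.

Theorem theorem3 (R : realType) (T1 T2 T3 : triangle R)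
  (O12 O23 O31 : point R)
  (h12 : homological T1 T2)
  (h23 : homological T2 T3)
  (h31 : homological T3 T1)
  (c12 : homological_center T1 T2 O12)
  (c23 : homological_center T2 T3 O23)
  (c31 : homological_center T3 T1 O31)
  (* general position: corresponding vertices form proper triangles *)
  (gA : ~ collinear (vA T1) (vA T2) (vA T3))
  (gB : ~ collinear (vB T1) (vB T2) (vB T3))
  (gC : ~ collinear (vC T1) (vC T2) (vC T3))
  (hO : collinear O12 O23 O31) :
  exists l : line R,
    [/\ homological_axis T1 T2 l, homological_axis T2 T3 l
      & homological_axis T3 T1 l].
Proof.
case: h12 => A12 B12 C12 [AB12 BC12 CA12 _].
case: h23 => A23 B23 C23 [AB23 BC23 CA23 _].
case: h31 => A31 B31 C31 [AB31 BC31 CA31 _].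
case: c12 c23 c31 => a12 b12 c12 [a23 b23 c23] [a31 b31 c31].
have [AB1 BC1 CA1] := noncollinear_neq (triangle_proper (t := T1)).
have [AB2 BC2 CA2] := noncollinear_neq (triangle_proper (t := T2)).
have [AB3 BC3 CA3] := noncollinear_neq (triangle_proper (t := T3)).
(* [P], [Q], [S] are the common points of the sides BC, CA, AB respectively, each shared by all
   three pairs of triangles. *)
have [P [P12 P23 P31]] := sides_common_point gB gC BC1 BC2 BC3 BC12 BC23 BC31
  b12 c12 b23 c23 b31 c31 hO.
have [Q [Q12 Q23 Q31]] := sides_common_point gC gA CA1 CA2 CA3 CA12 CA23 CA31
  c12 a12 c23 a23 c31 a31 hO.
have [S [S12 S23 S31]] := sides_common_point gA gB AB1 AB2 AB3 AB12 AB23 AB31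
  a12 b12 a23 b23 a31 b31 hO.
(* A point lying on the sides BC and CA of T1 and T2 is C1 as well as C2. *)
have PQ : P != Q.
  apply: contraNneq C12 => ePQ.
  have [P1 P2] : (P <= through (vB T1) (vC T1))%VS /\ (P <= through (vB T2) (vC T2))%VS.
    by rewrite -P12 capvSl capvSr.
  have [Q1 Q2] : (P <= through (vC T1) (vA T1))%VS /\ (P <= through (vC T2) (vA T2))%VS.
    by rewrite ePQ -Q12 capvSl capvSr.
  have <- : P = vC T1.
    apply: point_sub_eq.
    by rewrite -(sides_meet_vertex (triangle_proper (t := T1))) subv_cap P1.
  apply/eqP/point_sub_eq.
  by rewrite -(sides_meet_vertex (triangle_proper (t := T2))) subv_cap P2.
(* Desargues' theorem for the single pair [T1], [T2] suffices, because the other pairs have the same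
   [P], [Q], [S]. *)
have SPQ : (S <= through P Q)%VS.
  exact: desargues (triangle_proper (t := T1)) (triangle_proper (t := T2))
    a12 b12 c12 P12 Q12 S12.
have /eqP dimPQ := dim_through PQ.
by exists (Line dimPQ); split; apply: axis_through SPQ _ _.
Qed.
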